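(* There is a nonnegative function $\varphi$ with $\lim_{\epsilon\to0}\varphi(\epsilon)=0$ such that the following holds. For each small enough $\epsilon>0$ let $\epsilon_0=\epsilon^{2\epsilon^{-1}}$. Then for each $\epsilon_0$-uniform set $S$ of $\delta$-intervals (or equivalently, of $\delta$-tubes intersecting a fixed $\delta$-square) there exist a partition $$0=A_1<A_2<\ldots<A_{L+1}=1$$ and a sequence $$0\le t_1<t_2<\ldots<t_L\le1$$ such that, for each $1\le l\le L$ in (i)–(iii), (i) $A_{l+1}-A_l\ge\psi(\epsilon):=\epsilon_0\epsilon^{-1}$; (ii) $\log_{1/\delta}\left(\dfrac{|S|_{\delta^{A_{l+1}}}}{|S|_{\delta^{A_l}}}\right)\le(t_l+3\epsilon)(A_{l+1}-A_l)$; (iii) for each $I\in S_{\delta^{A_l}}$, the copy of $S_{\delta^{A_{l+1}}}[I]$ rescaled by the factor $\delta^{-A_l}$ is a $(\delta^{A_{l+1}-A_l},t_l,O(\delta^{(A_l-A_{l+1})\varphi(\epsilon)}))$-set with size in the interval $$\left[O(\delta^{(A_l-A_{l+1})(t_l-\varphi(\epsilon))}),\ O(\delta^{(A_l-A_{l+1})(t_l+\varphi(\epsilon))})\right],$$ i.e. $\gtrsim$ the first quantity and $\lesssim$ the second; (iv) $t_1\le\log_{1/\delta}|S|+\epsilon$. Moreover, $L$ is independent of $\delta$ (that is, bounded in terms of $\epsilon$ only).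
   Context: It is implicitly assumed that $\delta$ is small enough depending on $\epsilon$; scales may be assumed dyadic. $\lesssim$, $\gtrsim$ and $O(\cdot)$ hide constants independent of $\delta$ and $S$ (they may depend on $\epsilon$). $|A|_\rho$ is the smallest number of balls of radius $\rho$ needed to cover $A$; for a collection of $\delta$-intervals, $|A|_\delta$ is identified with its cardinality $|A|$. For a set $S$ of $\delta$-intervals in the standard (dyadic) grid of $[0,1]$ and $\rho\ge\delta$, $S_\rho$ is the set of grid $\rho$-intervals containing some interval of $S$; for $\rho'\le\rho$ and $I\in S_\rho$, $S_{\rho'}[I]=\{I'\in S_{\rho'}: I'\subset I\}$, and $S[I]=S_\delta[I]$. A non-empty set $A\subset\mathbb{R}^d$ of diameter $\lesssim1$ is a $(\delta,s,C)$-set if $|A\cap B(x,r)|_\delta\le Cr^s|A|_\delta$ for all $x\in\mathbb{R}^d$ and $r\in[\delta,1]$ (the same inequality is used if the exponent is $0$). Uniform sets: given $\epsilon>0$, let $T_\epsilon$ satisfy $T_\epsilon^{-1}\log(2T_\epsilon)=\epsilon$. Given $0<\delta\le2^{-T_\epsilon}$, let $m$ be the largest natural number such that $\frac1m\log_2\delta^{-1}\ge T_\epsilon$ and let $T=T(\delta,\epsilon)=\frac1m\log_2\delta^{-1}$; thus $T_\epsilon\le T\le2T_\epsilon$ and $\delta=2^{-mT}$. A set $S$ of $\delta$-intervals is $\epsilon$-uniform if for each $\rho=2^{-jT}$, $0\le j\le m$, and each $I_1,I_2\in S_\rho$ we have $|S[I_1]|=|S[I_2]|$. The same definition is used for squares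 and for tubes. *)

(* Defs.v *)
From mathcomp Require Export all_boot all_order all_algebra.
From mathcomp Require Export all_classical all_reals all_analysis.
Export numFieldNormedType.Exports.

Set Implicit Arguments.
Unset Strict Implicit.
Unset Printing Implicit Defensive.

Import Order.TTheory GRing.Theory Num.Theory.
Local Open Scope classical_set_scope.
Local Open Scope ring_scope.

Definition logb {R : realType} (b x : R) : R := ln x / ln b.

(* A is covered by n balls of radius rho. Open and closed balls give covering
   numbers comparable up to an absolute constant. *)
Definition covered_by {R : realType} (rho : R) (A : set R) (n : nat) : Prop :=
  exists c : 'I_n -> R, A `<=` \bigcup_(i in [set: 'I_n]) ball (c i) rho.

(* |A|_rho. The default value 0 is only reached when no finite cover exists,
   i.e. when A is unbounded or when A is nonempty and rho <= 0. *)
Definition covnum {R : realType} (rho : R) (A : set R) : nat :=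
  xget 0%N [set n | covered_by rho A n /\
                    forall k, covered_by rho A k -> (n <= k)%N].

(* (delta, s, C)-sets in dimension one; D is the implicit constant of the
   requirement "diameter <~ 1". *)
Definition delta_set {R : realType} (D delta s C : R) (A : set R) : Prop :=
  [/\ A !=set0,
      forall x y, A x -> A y -> `|x - y| <= D
    & forall x r : R, delta <= r <= 1 ->
        (covnum delta (A `&` ball x r))%:R
          <= C * r `^ s * (covnum delta A)%:R].

(* The dyadic interval of length 2^-n with index k. A finite set of grid
   intervals of length 2^-n in [0,1] is given by its set of indices, of type
   {set 'I_(2 ^ n)}. *)
Definition grid (R : realType) (n k : nat) : set R :=
  `[k%:R / 2 ^+ n, k.+1%:R / 2 ^+ n[.
Arguments grid R n k : clear implicits.

Definition gridU (R : realType) (n : nat) (S : {set 'I_(2 ^ n)}) : set R :=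
  \bigcup_(k in [set` S]) grid R n k.
Arguments gridU R {n} S.

(* Scales need not be powers of 2: for 0 < rho <= 1, a grid rho-interval is a
   dyadic interval whose length 2 ^- lev rho lies in [rho, 2 rho[. *)
Definition lev {R : realType} (rho : R) : nat := Num.truncn (logb 2 rho^-1).

(* S_rho: the grid rho-intervals containing some interval of S. *)
Definition coarse {R : realType} (N : nat) (S : {set 'I_(2 ^ N)}) (rho : R) :
    {set 'I_(2 ^ lev rho)} :=
  [set k : 'I_(2 ^ lev rho) |
    `[< exists2 i : 'I_(2 ^ N), i \in S &
          grid R N i `<=` grid R (lev rho) k >]]%SET.

(* The members of Q contained in the interval of length 2^-n with index k. *)
Definition inside (R : realType) (n' : nat) (Q : {set 'I_(2 ^ n')})
    (n k : nat) : {set 'I_(2 ^ n')} :=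
  [set i in Q | `[< grid R n' i `<=` grid R n k >]]%SET.
Arguments inside R {n'} Q n k.

(* T = T_eps. For small eps the equation log(2T)/T = eps has a second root
   near 1/2, which 1 <= T excludes. *)
Definition is_Teps {R : realType} (eps T : R) : Prop :=
  1 <= T /\ T^-1 * ln (2 * T) = eps.

(* m is the largest (positive) natural number with
   log_2 (1/delta) / m >= Te. *)
Definition is_nblocks {R : realType} (delta Te : R) (m : nat) : Prop :=
  [/\ (0 < m)%N, Te <= m%:R^-1 * logb 2 delta^-1
    & forall m' : nat, (0 < m')%N -> Te <= m'%:R^-1 * logb 2 delta^-1 ->
        (m' <= m)%N].

(* S is an eps-uniform set of delta-intervals, delta = 2^-N. Te and m are
   determined by eps and delta. *)
Definition uniform_intervals {R : realType} (eps : R) (N : nat)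
    (S : {set 'I_(2 ^ N)}) : Prop :=
  let delta : R := 2 ^- N in
  exists (Te : R) (m : nat),
    [/\ is_Teps eps Te, delta <= 2 `^ (- Te), is_nblocks delta Te m
      & let T := m%:R^-1 * logb 2 delta^-1 in
        forall j : nat, (j <= m)%N ->
          let rho := 2 `^ (- (j%:R * T)) in
          forall I1 I2, I1 \in coarse S rho -> I2 \in coarse S rho ->
            #|inside R S (lev rho) I1| = #|inside R S (lev rho) I2| ].

(* Main.v *)
(* With delta = 2^-N and T = N/m, let P j be the number of 2^(-jT)-intervals
   meeting S and f j = log2 (P j) / T, a nondecreasing function on {0, ..., m}
   that is (1 + eps)-Lipschitz because T is large. Uniformity makes P j' / P j
   the number of descendants of every interval of generation j, so every claim
   is about f. For the slopes k sigma, with sigma = (1 + eps) / n and n about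
   1 / (2 eps), let b k minimize f i - k sigma i. Between b k and b (k+1), f lies
   above the line of slope k sigma through b k and its mean slope is at most
   (k+1) sigma <= k sigma + 2 eps. Since there are only n pieces, some p <= n is
   such that every piece is either longer than theta^p m or shorter than
   theta^(p+1) m, with theta = eps^3; the short pieces are negligible and are
   merged into their neighbours. *)
Require Import Defs.
From mathcomp Require Import lra ring zify.
Import Order.TTheory GRing.Theory Num.Theory.
Local Open Scope classical_set_scope.
Local Open Scope ring_scope.

(** * Slopes of the branching function *)

(** Raising the slope moves minimizers to the right, however ties are broken. At the extreme slopes
    0 and [n * sigma], nonnegativity and the Lipschitz bound make 0 and [m] minimizers. *)
Lemma slope_minimizers (R : realType) (f : nat -> R) (m n : nat) (sigma : R) :
  (0 < n)%N -> 0 < sigma -> f 0%N = 0 ->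
  (forall i, (i <= m)%N -> 0 <= f i) ->
  (forall i, (i <= m)%N -> f m - f i <= n%:R * sigma * (m%:R - i%:R)) ->
  exists b : nat -> nat,
    [/\ b 0%N = 0%N, b n = m, forall k, (b k <= m)%N,
        {homo b : j k / (j <= k)%N}
      & forall k i, (i <= m)%N ->
          f (b k) - k%:R * sigma * (b k)%:R <= f i - k%:R * sigma * i%:R].
Proof.
move=> n_gt0 sigma_gt0 f0 f_ge0 f_lip.
(* Ties are possible at the extreme slopes, so there the minimizer is prescribed. *)
have minimizer k : exists j, [/\ (j <= m)%N, (k = 0 -> j = 0)%N,
    (k = n -> j = m)%N & forall i, (i <= m)%N ->
    f j - k%:R * sigma * j%:R <= f i - k%:R * sigma * i%:R].
  have [->|k_neq0] := eqVneq k 0%N.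
    exists 0%N; split=> // [E|i im]; first by rewrite -E in n_gt0.
    by rewrite f0 !mul0r !subr0 f_ge0.
  have [->|k_neqn] := eqVneq k n.
    exists m; split=> // [E|i im]; first by rewrite E in n_gt0.
    by have := f_lip i im; nra.
  pose g (i : 'I_m.+1) := f i - k%:R * sigma * i%:R.
  have [i _ imin] := @arg_minP _ R _ ord0 xpredT g isT.
  exists i; split=> [|E|E|j jm]; first by rewrite -ltnS.
  - by rewrite E in k_neq0.
  - by rewrite E eqxx in k_neqn.
  - by have := imin (Ordinal (jm : (j < m.+1)%N)) isT.
have [b bP] := boolp.choice minimizer.
exists b; split=> [||k|j k|k i im].
- by have [_ E _ _] := bP 0%N; exact: E.
- by have [_ _ E _] := bP n; exact: E.
- by have [] := bP k.
(* If [b k < b j] for some [j < k], adding the two minimality inequalities makes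
   [(k - j) * sigma * (b j - b k)] at most 0. *)
- rewrite leq_eqVlt => /predU1P[->//|jk]; rewrite leqNgt; apply/negP => bkj.
  have [bj_le _ _ bj_min] := bP j; have [bk_le _ _ bk_min] := bP k.
  have := bj_min _ bk_le; have := bk_min _ bj_le.
  have jkR : j%:R < k%:R :> R by rewrite ltr_nat.
  have bR : (b k)%:R < (b j)%:R :> R by rewrite ltr_nat.
  have : 0 < (k%:R - j%:R) * sigma * ((b j)%:R - (b k)%:R).
    by rewrite !mulr_gt0 // subr_gt0.
  lra.
- by have [_ _ _ ->] := bP k.
Qed.

Lemma scale_gap (R : realType) (n : nat) (d : 'I_n -> R) (theta : R) :
  0 < theta < 1 -> (exists k, theta <= d k) ->
  exists2 p, (0 < p <= n)%N &
    forall k, theta ^+ p <= d k \/ d k < theta ^+ p.+1.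
Proof.
move=> /andP[theta_gt0 theta_lt1] [k0 dk0].
pose B p : {set 'I_n} := [set k | theta ^+ p <= d k]%SET.
(* Increasing nonempty subsets of 'I_n: among B 1, ..., B n.+1 two consecutive
   ones coincide. *)
have BS p : B p \subset B p.+1.
  apply/fintype.subsetP => k; rewrite !inE; apply: le_trans.
  by rewrite exprS ler_piMl ?exprn_ge0 // ltW.
have [[p p_le BE]|noE] := pselect (exists2 p, (0 < p <= n)%N & B p = B p.+1).
  exists p => // k; have [dk|dk] := leP (theta ^+ p.+1) (d k); last by right.
  have : k \in B p.+1 by rewrite inE.
  by rewrite -BE inE; left.
have cardB p : (0 < p <= n.+1)%N -> (p <= #|B p|)%N.
  elim: p => // -[_ _|p IH p_le].
    by apply/card_gt0P; exists k0; rewrite inE expr1.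
  apply: leq_ltn_trans (IH _) _; first by lia.
  apply: proper_card; rewrite finset.properEneq BS andbT; apply/negP => /eqP E.
  by apply: noE; exists p.+1.
have := cardB n.+1; rewrite ltnSn => /(_ isT).
by rewrite ltnNge -[X in (_ <= X)%N](card_ord n) max_card.
Qed.

(** This lists the long pieces in order. The list is read by [nth] with default value [n], so that
    [k L = n] closes the run of short pieces after the last long one. *)
Lemma enum_below (B : pred nat) (n : nat) : has B (iota 0 n) ->
  exists (L : nat) (k : nat -> nat),
    [/\ (0 < L <= n)%N, k L = n,
        forall l, (l < L)%N -> B (k l) /\ (k l < k l.+1 <= n)%N,
        forall i, (i < k 0%N)%N -> ~~ B i
      & forall l i, (l < L)%N -> (k l < i < k l.+1)%N -> ~~ B i].
Proof.
rewrite has_filter => s_neq0; pose s := seq.filter B (iota 0 n).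
have s_sorted : sorted ltn s.
  by rewrite sorted_filter ?iota_ltn_sorted//; exact: ltn_trans.
have s_mem i : (i \in s) = B i && (i < n)%N.
  by rewrite mem_filter mem_iota.
have s_lt l : (l < size s)%N -> B (nth n s l) /\ (nth n s l < n)%N.
  by move=> /(mem_nth n); rewrite s_mem => /andP[].
have s_le l : (nth n s l <= n)%N.
  case: (ltnP l (size s)) => [/s_lt[_ /ltnW//]|ls]; by rewrite nth_default.
have s_homo l l' : (l < l')%N -> (l < size s)%N -> (nth n s l < nth n s l')%N.
  move=> ll' ls; case: (ltnP l' (size s)) => ls'.
    exact: (sorted_ltn_nth ltn_trans).
  by rewrite [X in (_ < X)%N]nth_default//; have [] := s_lt _ ls.
have s_idx i : B i -> (i < n)%N -> exists2 p, (p < size s)%N & nth n s p = i.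
  by move=> Bi i_n; apply/nthP; rewrite s_mem Bi.
have s_homo_le l l' : (l <= l')%N -> (nth n s l <= nth n s l')%N.
  rewrite leq_eqVlt => /predU1P[->//|ll'].
  case: (ltnP l (size s)) => ls; first exact/ltnW/s_homo.
  by rewrite !nth_default // (leq_trans ls) // ltnW.
exists (size s), (nth n s); split=> [||l ls|i i_lt|l i ls /andP[i_gt i_lt]].
- by rewrite lt0n size_eq0 s_neq0 size_filter (leq_trans (count_size _ _))// size_iota.
- by rewrite nth_default.
- by have [Bl _] := s_lt _ ls; rewrite s_homo//= s_le.
- apply/negP => Bi; have [|p ps pi] := s_idx i Bi.
    exact: leq_trans i_lt (s_le _).
  by have := s_homo_le 0%N p isT; rewrite pi leqNgt i_lt.
- apply/negP => Bi; have [|p ps pi] := s_idx i Bi.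
    exact: leq_trans i_lt (s_le _).
  case: (leqP p l) => [/s_homo_le|lp]; first by rewrite pi leqNgt i_gt.
  by have := s_homo_le _ _ lp; rewrite pi leqNgt i_lt.
Qed.

Lemma small_increments (R : realType) (b : nat -> nat) (eta : R) (i j : nat) :
  (i <= j)%N ->
  (forall k, (i <= k < j)%N -> (b k.+1)%:R - (b k)%:R <= eta) ->
  (b j)%:R - (b i)%:R <= (j - i)%:R * eta.
Proof.
move=> ij; rewrite -(subnKC ij); move: (j - i)%N => d; rewrite addKn.
elim: d => [|d IH] b_le; first by rewrite addn0 mul0r subrr.
have := IH (fun k => ltac:(move=> kd; apply: b_le; lia)).
have := b_le (i + d)%N ltac:(lia).
rewrite addnS -natr1; lra.
Qed.

(** Each long piece absorbs the short ones beside it. Its slope bounds come from the minimality of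
    its two ends, and the absorbed runs cost at most [eps] times its length. *)
Lemma slope_partition (R : realType) (eps : R) (n m : nat) (f : nat -> R) :
  0 < eps -> eps <= 14^-1 ->
  1 + eps <= 2 * eps * n%:R -> n%:R * eps <= 1 + eps ->
  (0 < m)%N -> f 0%N = 0 ->
  (forall i j, (i <= j)%N -> (j <= m)%N -> f i <= f j) ->
  (forall i j, (i <= j)%N -> (j <= m)%N ->
     f j - f i <= (1 + eps) * (j%:R - i%:R)) ->
  exists (L : nat) (a : nat -> nat) (t : nat -> R),
    [/\ (0 < L <= n)%N, a 0%N = 0%N /\ a L = m,
        forall l, (l < L)%N -> 0 <= t l <= 1 /\
          ((l.+1 < L)%N -> t l < t l.+1),
        forall l, (l < L)%N ->
          let len := (a l.+1)%:R - (a l)%:R in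
          [/\ (a l < a l.+1)%N /\ (a l.+1 <= m)%N,
              (eps ^+ 3) ^+ n * m%:R <= len,
              f (a l.+1) - f (a l) <= (t l + 3 * eps) * len
            & forall i, (a l <= i <= a l.+1)%N ->
                f (a l) + t l * (i%:R - (a l)%:R) - eps * len <= f i]
      & t 0%N * m%:R <= f m + eps * m%:R].
Proof.
move=> eps_gt0 eps_le n_ge n_le m_gt0 f0 f_homo f_lip.
have n_gt0 : (0 < n)%N by rewrite -(ltr0n R); nra.
have nR_gt0 : 0 < n%:R :> R by rewrite ltr0n.
have mR_gt0 : 0 < m%:R :> R by rewrite ltr0n.
pose sigma := (1 + eps) / n%:R.
have sigma_gt0 : 0 < sigma by rewrite divr_gt0//; lra.
have nsigma : n%:R * sigma = 1 + eps by rewrite /sigma mulrC divfK// gt_eqF.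
have sigma_le : sigma <= 2 * eps by rewrite ler_pdivrMr.
have f_ge0 i : (i <= m)%N -> 0 <= f i by move=> im; rewrite -f0; exact: f_homo.
have := @slope_minimizers R f m n sigma n_gt0 sigma_gt0 f0 f_ge0.
rewrite nsigma => /(_ (fun i im => f_lip i m im (leqnn m))).
move=> [b [b0 bn b_le b_homo b_min]].
pose theta := eps ^+ 3.
have theta_gt0 : 0 < theta by rewrite exprn_gt0.
have theta_lt : 2 * n%:R * theta <= eps.
  have -> : 2 * n%:R * theta = 2 * (n%:R * eps) * eps ^+ 2 by rewrite /theta; ring.
  nra.
have theta_lt1 : theta < 1 by rewrite exprn_ilt1//; lra.
pose len k : R := (b k.+1)%:R - (b k)%:R.
have [p p_le p_gap] : exists2 p, (0 < p <= n)%N & forall k : 'I_n,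
    theta ^+ p <= len k / m%:R \/ len k / m%:R < theta ^+ p.+1.
  apply: (@scale_gap R n (fun k => len k / m%:R)); first by rewrite theta_gt0.
  (* If every piece were shorter than [theta * m], the total length [m] would be at most
     [n * theta * m], which is less than [m]. *)
  apply/not_existsP => small.
  have incr k : (0 <= k < n)%N -> (b k.+1)%:R - (b k)%:R <= theta * m%:R.
    move=> /= k_lt; have /negP := small (Ordinal k_lt).
    by rewrite -ltNge /= ltr_pdivrMr// => /ltW.
  have := @small_increments R b _ 0 n isT incr.
  rewrite b0 bn subn0 subr0 mulrA -[X in X <= _]mul1r ler_pM2r//; nra.
pose eta := theta ^+ p.+1 * m%:R.
pose big k := theta ^+ p * m%:R <= len k.
have small_len k : (k < n)%N -> ~~ big k -> len k <= eta.
  move=> kn; rewrite /big -ltNge => k_small.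
  have [|] := p_gap (Ordinal kn) => /=.
    by rewrite ler_pdivlMr// leNgt k_small.
  by rewrite ltr_pdivrMr// => /ltW.
have thetap_gt0 : 0 < theta ^+ p by rewrite exprn_gt0.
have eta_gt0 : 0 < eta by rewrite mulr_gt0// exprn_gt0.
(* A run of short pieces has length at most [n * eta]. Even at slope 2 it changes [f] by at most
   [eps] times the length of one long piece; the choice of [theta] as the cube of [eps], with
   [n * eps <= 1 + eps], ensures this. *)
have eta_big k : big k -> 2 * (n%:R * eta) <= eps * len k.
  rewrite /big /eta exprS => Bk.
  have : eps * (theta ^+ p * m%:R) <= eps * len k by rewrite ler_pM2l.
  have : 2 * n%:R * theta * (theta ^+ p * m%:R) <= eps * (theta ^+ p * m%:R).
    by rewrite ler_pM2r// mulr_gt0.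
  nra.
have gap_le i j : (i <= j <= n)%N -> (forall k, (i <= k < j)%N -> ~~ big k) ->
    (b j)%:R - (b i)%:R <= n%:R * eta.
  move=> /andP[ij jn] nbig; apply: le_trans (small_increments _ _ eta _ _ ij _) _.
    move=> k kij; apply: small_len (nbig _ kij).
    by case/andP: kij => _ /leq_trans; apply.
  by rewrite ler_wpM2r ?(ltW eta_gt0)// ler_nat (leq_trans (leq_subr _ _) jn).
have has_big : has big (iota 0 n).
  apply/negPn/negP => /hasPn nbig.
  have small k : (0 <= k < n)%N -> ~~ big k.
    by move=> kn; apply: nbig; rewrite mem_iota.
  have := gap_le 0%N n (leqnn n) small; rewrite b0 bn subr0.
  rewrite leNgt => /negP; apply.
  rewrite /eta mulrA gtr_pMl// exprS mulrA.
  have : theta ^+ p <= 1 by rewrite exprn_ile1// ltW.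
  nra.
have [L [k [L_le kL kP k0_small k_small]]] := enum_below big n has_big.
have k_lt l : (l < L)%N -> (k l < k l.+1)%N by move=> /kP[_ /andP[]].
have k_le l : (l < L)%N -> (k l.+1 <= n)%N by move=> /kP[_ /andP[]].
(* Short pieces join the long piece on their left; those before the first long
   piece join that one. *)
pose a l := if l is 0 then 0%N else b (k l).
pose t l := (k l)%:R * sigma.
exists L, a, t.
have L_gt0 : (0 < L)%N by case/andP: L_le.
have left_gap l : (l < L)%N -> (a l <= b (k l))%N /\
    (b (k l))%:R - (a l)%:R <= n%:R * eta.
  case: l => [|l] lL /=; last by rewrite subrr mulr_ge0// ltW.
  split=> //; have := gap_le 0%N (k 0%N); rewrite b0; apply=> [|i /k0_small//].
  by rewrite leq0n (leq_trans (ltnW (k_lt _ lL)) (k_le _ lL)).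
have right_gap l : (l < L)%N -> (b (k l).+1 <= a l.+1)%N /\
    (a l.+1)%:R - (b (k l).+1)%:R <= n%:R * eta.
  move=> lL /=; have kl_lt := k_lt _ lL; split; first exact: b_homo.
  by apply: gap_le => [|i]; [rewrite kl_lt k_le|exact: k_small].
have L_case : L = L.-1.+1 by rewrite prednK.
split=> //.
- by split=> //; rewrite /a L_case -L_case kL bn.
- move=> l lL; have kl_lt := k_lt _ lL.
  (* A long piece has index at most [n - 1], and [(n - 1) * sigma <= 1] amounts to
     [n * eps <= 1 + eps]. *)
  have kn : (k l)%:R + 1 <= n%:R :> R.
    by rewrite natr1 ler_nat (leq_trans kl_lt)// k_le.
  split=> [|l1L]; last by rewrite /t ltr_pM2r// ltr_nat.
  apply/andP; split; first by rewrite mulr_ge0 ?(ltW sigma_gt0).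
  rewrite -(ler_pM2r nR_gt0) /t -mulrA (mulrC sigma) nsigma.
  nra.
- move=> l lL /=; rewrite -/(a l.+1).
  have [Bk _] := kP _ lL; have kl_lt := k_lt _ lL; have kn := k_le _ lL.
  have [al_le al_gap] := left_gap _ lL; have [ar_le ar_gap] := right_gap _ lL.
  have am : (a l.+1 <= m)%N by exact: b_le.
  have al_leR : (a l)%:R <= (b (k l))%:R :> R by rewrite ler_nat.
  have ar_leR : (b (k l).+1)%:R <= (a l.+1)%:R :> R by rewrite ler_nat.
  have len_le : len (k l) <= (a l.+1)%:R - (a l)%:R by rewrite /len; lra.
  have len_gt0 : 0 < len (k l) by apply: lt_le_trans Bk; rewrite mulr_gt0.
  have eta_le : 2 * (n%:R * eta) <= eps * ((a l.+1)%:R - (a l)%:R).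
    by apply: le_trans (eta_big _ Bk) _; rewrite ler_pM2l.
  have tl_ge0 : 0 <= t l by rewrite mulr_ge0 ?(ltW sigma_gt0).
  have tl_le : t l <= 1 + eps.
    rewrite -nsigma /t ler_pM2r// ler_nat.
    exact: leq_trans (ltnW kl_lt) kn.
  split.
  + split=> //; rewrite -(ltr_nat R); lra.
  + apply: le_trans len_le; apply: le_trans Bk; rewrite ler_pM2r//.
    rewrite -/theta; case/andP: p_le => _ /subnKC <-.
    rewrite exprD ler_piMr ?(ltW thetap_gt0)//.
    by apply: exprn_ile1; exact: ltW.
  (* Minimality of [b (k l).+1] tested at [a l] bounds the mean slope up to that point by
     [t l + sigma], where [sigma <= 2 * eps]. The short pieces after it, at slope at most [1 + eps],
     contribute the third [eps]. *)
  + have lip := f_lip _ _ ar_le am.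
    have := b_min (k l).+1 (a l) (leq_trans al_le (b_le _)).
    rewrite -natr1 mulrDl mul1r -/(t l) => mina.
    have d_ge0 : 0 <= (b (k l).+1)%:R - (a l)%:R :> R.
      have : 0 < (b (k l).+1)%:R - (b (k l))%:R :> R by [].
      lra.
    have : (t l + sigma) * ((b (k l).+1)%:R - (a l)%:R) <=
           (t l + 2 * eps) * ((b (k l).+1)%:R - (a l)%:R).
      by rewrite ler_wpM2r//; lra.
    have : 0 <= (t l + 2 * eps) * ((a l.+1)%:R - (b (k l).+1)%:R).
      by rewrite mulr_ge0//; lra.
    have : (1 + eps) * ((a l.+1)%:R - (b (k l).+1)%:R) <= 2 * (n%:R * eta).
      nra.
    nra.
  (* Minimality of [b (k l)] is tested at [i]. Since [f (a l) <= f (b (k l))], the only loss is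
     [t l] times the gap between [a l] and [b (k l)]. *)
  + move=> i /andP[ai ia].
    have := b_min (k l) i (leq_trans ia am); rewrite -/(t l) => mini.
    have := f_homo _ _ al_le (b_le _) => fa.
    have : t l * ((b (k l))%:R - (a l)%:R) <= 2 * (n%:R * eta) by nra.
    nra.
- have [Bk _] := kP _ L_gt0; have kl_lt := k_lt _ L_gt0.
  have [a0_le a0_gap] := left_gap _ L_gt0.
  rewrite subr0 in a0_gap.
  (* Testing minimality at [m] compares [t 0 * m] with [f m], up to [t 0] times the gap before the
     first long piece. *)
  have := b_min (k 0%N) m (leqnn _); rewrite -/(t 0%N) => minm.
  have := f_ge0 _ (b_le (k 0%N)) => fb.
  have tl_le : t 0%N <= 1 + eps.
    rewrite -nsigma /t ler_pM2r// ler_nat.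
    exact: leq_trans (ltnW kl_lt) (k_le _ L_gt0).
  have := eta_big _ Bk.
  have : eps * len (k 0%N) <= eps * m%:R.
    rewrite ler_pM2l// /len.
    have : (b (k 0%N).+1)%:R <= m%:R :> R by rewrite ler_nat.
    have : 0 <= (b (k 0%N))%:R :> R by [].
    lra.
  have : t 0%N * (b (k 0%N))%:R <= 2 * (n%:R * eta).
    have : 0 <= (b (k 0%N))%:R :> R by [].
    nra.
  nra.
Qed.

(** * Dyadic descendants *)

(** Index arithmetic replaces inclusion of intervals: the ancestor of generation [n <= N] of the
    cell [i] has index [i %/ 2 ^ (N - n)], by [grid_subset]. *)
Definition cells (N : nat) (S : {set 'I_(2 ^ N)}) (n : nat) :
    {set 'I_(2 ^ n)} :=
  [set k : 'I_(2 ^ n) | [exists i in S, (i %/ 2 ^ (N - n) == k)%N]]%SET.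
Arguments cells {N} S n.

Definition below (n' : nat) (Q : {set 'I_(2 ^ n')}) (n k : nat) :
    {set 'I_(2 ^ n')} :=
  [set i in Q | (i %/ 2 ^ (n' - n) == k)%N]%SET.
Arguments below {n'} Q n k.

(** Intervals are half-open, so the left endpoint of the small one already determines the large one.
    Scaling by the N-th power of 2 turns membership into inequalities between integers. *)
Lemma grid_subset (R : realType) (n N i k : nat) : (n <= N)%N ->
  grid R N i `<=` grid R n k <-> (i %/ 2 ^ (N - n))%N = k.
Proof.
move=> nN; set q := (2 ^ (N - n))%N.
have q_gt0 : (0 < q)%N by rewrite expn_gt0.
have qR : q%:R * 2 ^+ n = 2 ^+ N :> R by rewrite natrX -exprD subnK.
have pow_gt0 p : 0 < 2 ^+ p :> R by rewrite exprn_gt0.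
have gridP p j (x : R) :
    grid R p j x <-> j%:R <= x * 2 ^+ p /\ x * 2 ^+ p < j.+1%:R.
  rewrite /grid /= in_itv /= ler_pdivrMr// ltr_pdivlMr//.
  by split=> [/andP|[-> ->]].
have low (x : R) j : (j%:R <= x * 2 ^+ n) = ((j * q)%:R <= x * 2 ^+ N).
  by rewrite -qR mulrCA natrM (mulrC _ q%:R) ler_pM2l ?ltr0n.
have up (x : R) j : (x * 2 ^+ n < j%:R) = (x * 2 ^+ N < (j * q)%:R).
  by rewrite -qR mulrCA natrM (mulrC _ q%:R) ltr_pM2l ?ltr0n.
split=> [sub|<-].
  have iN : grid R N i (i%:R / 2 ^+ N).
    by apply/gridP; rewrite divfK ?gt_eqF// lexx ltr_nat.
  have /gridP := sub _ iN; rewrite low up divfK ?gt_eqF// ler_nat ltr_nat => -[ki ik].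
  by apply/eqP; rewrite eqn_leq leq_divRL// ki andbT -ltnS ltn_divLR.
move=> x /gridP; rewrite -/q => -[lo hi]; apply/gridP; rewrite low up; split.
  by apply: le_trans lo; rewrite ler_nat leq_divM.
apply: lt_le_trans hi _; rewrite ler_nat.
by rewrite -ltn_divLR.
Qed.

Lemma coarse_cells (R : realType) (N : nat) (S : {set 'I_(2 ^ N)}) (rho : R) :
  (lev rho <= N)%N -> coarse S rho = cells S (lev rho).
Proof.
move=> levN; apply/setP => k; rewrite !inE.
apply/asboolP/exists_inP => -[i iS] => [/(grid_subset _ _ _ _ _ levN)/eqP E|/eqP E].
  by exists i.
by exists i => //; apply/grid_subset.
Qed.

Lemma inside_below (R : realType) (n n' k : nat) (Q : {set 'I_(2 ^ n')}) :
  (n <= n')%N -> inside R Q n k = below Q n k.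
Proof.
move=> nn'; apply/setP => i; rewrite !inE; congr (_ && _).
by apply/asboolP/eqP => /(grid_subset _ _ _ _ _ nn').
Qed.

Lemma ancestor_subproof (n N : nat) (i : 'I_(2 ^ N)) : (n <= N)%N ->
  (i %/ 2 ^ (N - n) < 2 ^ n)%N.
Proof. by move=> nN; rewrite ltn_divLR ?expn_gt0// -expnD subnKC. Qed.

Lemma ancestor_ancestor (p n N i : nat) : (p <= n)%N -> (n <= N)%N ->
  (i %/ 2 ^ (N - n) %/ 2 ^ (n - p) = i %/ 2 ^ (N - p))%N.
Proof.
by move=> pn nN; rewrite -divnMA -expnD addnBA// subnK.
Qed.

Lemma card_fibers (n N c : nat) (X : {set 'I_(2 ^ N)}) : (n <= N)%N ->
  (forall k, k \in cells X n -> #|below X n k| = c) ->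
  #|X| = (#|cells X n| * c)%N.
Proof.
move=> nN fib; pose p (i : 'I_(2 ^ N)) := Ordinal (ancestor_subproof n N i nN).
rewrite -sum1_card (partition_big p (mem (cells X n))) => [|i iX] /=; last first.
  by rewrite inE; apply/exists_inP; exists i.
rewrite -sum_nat_const; apply: eq_bigr => k kX; rewrite -(fib k kX) -sum1_card.
by apply: eq_bigl => i; rewrite !inE -val_eqE.
Qed.

Definition uniform_at (N : nat) (S : {set 'I_(2 ^ N)}) (n : nat) : Prop :=
  forall I1 I2, I1 \in cells S n -> I2 \in cells S n ->
    #|below S n I1| = #|below S n I2|.
Arguments uniform_at {N} S n.

(** Both [S] and its part below [I] are counted through generation [n'], whose fibers all have the
    same size. Comparing with the count of [S] through generation [n] and cancelling that size gives
    the identity. *)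
Lemma card_descendants (n n' N : nat) (S : {set 'I_(2 ^ N)}) (I : 'I_(2 ^ n)) :
  (n <= n')%N -> (n' <= N)%N -> uniform_at S n -> uniform_at S n' ->
  I \in cells S n ->
  (#|below (cells S n') n I| * #|cells S n| = #|cells S n'|)%N.
Proof.
move=> nn' n'N un un' IS; have nN := leq_trans nn' n'N.
have [i iS iI] : exists2 i, i \in S & (i %/ 2 ^ (N - n))%N = I.
  by move: IS; rewrite inE => /exists_inP[i iS /eqP]; exists i.
pose I' := Ordinal (ancestor_subproof n' N i n'N).
have I'S : I' \in cells S n' by rewrite inE; apply/exists_inP; exists i.
have := card_fibers n N #|below S n I| S nN (fun k kS => un k I kS IS).
rewrite (card_fibers n' N #|below S n' I'| S n'N (fun k kS => un' k I' kS I'S)).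
have cE : cells (below S n I) n' = below (cells S n') n I.
  apply/setP => k; rewrite !inE; apply/exists_inP/andP.
    move=> [j]; rewrite inE => /andP[jS /eqP jI] /eqP jk.
    split; first by apply/exists_inP; exists j => //; apply/eqP.
    by rewrite -jk ancestor_ancestor// jI.
  move=> [/exists_inP[j jS /eqP jk]]; rewrite -jk ancestor_ancestor// => jI.
  by exists j => //; rewrite inE jS.
rewrite (card_fibers n' N #|below S n' I'| (below S n I) n'N); last first.
  rewrite cE => k; rewrite inE => /andP[kS /eqP kI]; rewrite -(un' k I' kS I'S).
  apply: eq_card => j; rewrite !inE -andbA; apply: andb_id2l => jS.
  apply/andb_idl => /eqP jk; by rewrite -(ancestor_ancestor n n')// jk kI.
rewrite cE mulnA => /eqP; rewrite eqn_pmul2r => [/eqP->|]; first exact: mulnC.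
by apply/card_gt0P; exists i; rewrite inE iS /=.
Qed.

(** Here [k] is any index: either nothing lies below it, or it is itself a cell of [S]. *)
Lemma card_descendants_le (n n' N k : nat) (S : {set 'I_(2 ^ N)}) :
  (n <= n')%N -> (n' <= N)%N -> uniform_at S n -> uniform_at S n' ->
  (#|below (cells S n') n k| * #|cells S n| <= #|cells S n'|)%N.
Proof.
move=> nn' n'N un un'.
have [-> //|[j]] := set_0Vmem (below (cells S n') n k); first by rewrite cards0.
rewrite !inE => /andP[/exists_inP[i iS /eqP ij] /eqP jk].
pose I := Ordinal (ancestor_subproof n N i (leq_trans nn' n'N)).
have <- : I = k :> nat by rewrite /= -jk -ij ancestor_ancestor.
rewrite card_descendants// inE; apply/exists_inP; by exists i.
Qed.

Lemma cells_full (N : nat) (S : {set 'I_(2 ^ N)}) : cells S N = S.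
Proof.
apply/setP => k; rewrite inE subnn; apply/exists_inP/idP.
  by move=> [i iS]; rewrite divn1 val_eqE => /eqP <-.
by move=> kS; exists k; rewrite // divn1.
Qed.

Lemma cells_root (N : nat) (S : {set 'I_(2 ^ N)}) : S != finset.set0 ->
  #|cells S 0| = 1%N.
Proof.
move=> /set0Pn[i iS]; apply/eqP; rewrite eqn_leq; apply/andP; split.
  by apply: leq_trans (max_card _) _; rewrite card_ord.
apply/card_gt0P; exists ord0; rewrite inE; apply/exists_inP; exists i => //.
by rewrite subn0 divn_small.
Qed.

Lemma card_cells_gt0 (N n : nat) (S : {set 'I_(2 ^ N)}) : (n <= N)%N ->
  S != finset.set0 -> (0 < #|cells S n|)%N.
Proof.
move=> nN /set0Pn[i iS]; apply/card_gt0P.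
exists (Ordinal (ancestor_subproof n N i nN)).
by rewrite inE; apply/exists_inP; exists i.
Qed.

Lemma card_below_le (n n' k : nat) (Q : {set 'I_(2 ^ n')}) : (n <= n')%N ->
  (#|below Q n k| <= 2 ^ (n' - n))%N.
Proof.
move=> nn'; set q := (2 ^ (n' - n))%N; have q_gt0 : (0 < q)%N by rewrite expn_gt0.
rewrite -[X in (_ <= X)%N]card_ord.
pose r (i : 'I_(2 ^ n')) : 'I_q := Ordinal (ltn_pmod i q_gt0).
rewrite -(@card_in_imset _ _ r) ?max_card// => i j.
rewrite !inE => /andP[_ /eqP ik] /andP[_ /eqP jk] /(congr1 val) /= ij.
by apply: val_inj; rewrite /= (divn_eq i q) (divn_eq j q) ij ik jk.
Qed.

Lemma card_cells_monotone (N n n' : nat) (S : {set 'I_(2 ^ N)}) :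
  (n <= n')%N -> (n' <= N)%N -> (#|cells S n| <= #|cells S n'|)%N.
Proof.
move=> nn' n'N.
have -> : cells S n = cells (cells S n') n; last first.
  pose r (i : 'I_(2 ^ n')) := Ordinal (ancestor_subproof n n' i nn').
  apply: leq_trans (leq_imset_card r _); apply/subset_leq_card.
  apply/fintype.subsetP => k; rewrite inE => /exists_inP[i iS /eqP ik].
  by apply/imsetP; exists i => //; apply: val_inj.
apply/setP => k; rewrite !inE; apply/exists_inP/exists_inP.
  move=> [i iS /eqP ik]; exists (Ordinal (ancestor_subproof n' N i n'N)).
    by rewrite inE; apply/exists_inP; exists i.
  by rewrite /= ancestor_ancestor// ik.
move=> [j]; rewrite inE => /exists_inP[i iS /eqP ij] jk.
by exists i => //; rewrite -(ancestor_ancestor n n')// ij.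
Qed.

Lemma card_cells_growth (N n n' : nat) (S : {set 'I_(2 ^ N)}) :
  (n <= n')%N -> (n' <= N)%N -> S != finset.set0 ->
  uniform_at S n -> uniform_at S n' ->
  (#|cells S n'| <= 2 ^ (n' - n) * #|cells S n|)%N.
Proof.
move=> nn' n'N S_neq0 un un'.
have /card_gt0P[I IS] := card_cells_gt0 N n S (leq_trans nn' n'N) S_neq0.
by rewrite -(card_descendants n n' N S I)// leq_mul2r card_below_le// orbT.
Qed.

(** Counted from the minimum, [g] takes at most three consecutive values. This turns bounded spread
    of cells into the factor 3 of the covering estimates. *)
Lemma card_close_fibers (T : finType) (Y : {set T}) (g : T -> nat) (c : nat) :
  {in Y &, forall y y', (g y < g y' + 3)%N} ->
  (forall k, #|[set y in Y | g y == k]%SET| <= c)%N ->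
  (#|Y| <= 3 * c)%N.
Proof.
move=> close fib; have [->|[y0 y0Y]] := set_0Vmem Y; first by rewrite cards0.
have [y yY ymin] := arg_minnP g y0Y.
pose F k := [set y' in Y | g y' == k]%SET.
have /subset_leq_card : Y \subset (F (g y) :|: F (g y).+1 :|: F (g y).+2)%SET.
  apply/fintype.subsetP => z zY; rewrite !inE zY /=.
  by have := ymin z zY; have := close _ _ zY yY; lia.
move/leq_trans; apply.
apply: leq_trans (leq_card_setU _ _) _.
have := (leq_card_setU (F (g y)) (F (g y).+1)).1.
have := fib (g y); have := fib (g y).+1; have := fib (g y).+2.
rewrite -/(F _) -/(F _) -/(F _); lia.
Qed.

(** * Covering numbers *)

(** Any finite cover excludes the default value 0 in [covnum]. *)
Lemma covnumP (R : realType) (rho : R) (A : set R) (n : nat) :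
  covered_by rho A n ->
  covered_by rho A (covnum rho A) /\ (covnum rho A <= n)%N.
Proof.
move=> An; rewrite /covnum.
case: xgetP => [k _ [Ak kmin]|noMin]; first by split=> //; exact: kmin.
have ex : exists k, `[< covered_by rho A k >] by exists n; apply/asboolP.
have [k /asboolP Ak kmin] := ex_minnP ex.
case: (noMin k); split=> // j Aj; apply: kmin; exact/asboolP.
Qed.

Lemma covered_by_card (R : realType) (T : finType) (Y : {set T}) (c : T -> R)
    (rho : R) (A : set R) :
  (forall x, A x -> exists2 k, k \in Y & ball (c k) rho x) ->
  covered_by rho A #|Y|.
Proof.
move=> cov; exists (fun i => c (enum_val i)) => x /cov[k kY xk].
by exists (enum_rank_in kY k) => //; rewrite enum_rankK_in.
Qed.

Lemma ballRE (R : realType) (c r x : R) : ball c r x <-> c - r < x < c + r.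
Proof. by rewrite /ball /= ltr_distlC; split. Qed.

(** The form of [gridU] after rescaling: the side [h] need not be a power of 2, because the
    rescaling factor is not. *)
Definition blocks (R : realType) (h : R) (M : nat) (X : {set 'I_M}) : set R :=
  [set y | exists2 k : 'I_M, k \in X & k%:R * h <= y < k.+1%:R * h].
Arguments blocks {R} h {M} X.

Lemma rescaled_gridU (R : realType) (lam : R) (n : nat) (X : {set 'I_(2 ^ n)}) :
  0 < lam ->
  [set lam * x | x in gridU R X] = blocks (lam / 2 ^+ n) X.
Proof.
move=> lam_gt0; have p_gt0 : 0 < 2 ^+ n :> R by rewrite exprn_gt0.
have E (j : nat) : j%:R * (lam / 2 ^+ n) = lam * (j%:R / 2 ^+ n) :> R by ring.
apply/seteqP; split=> y.
  move=> [x [k /= kX]]; rewrite /grid /= in_itv /= => /andP[lo hi] <-.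
  by exists k => //; rewrite !E ler_pM2l// ltr_pM2l// lo.
move=> [k kX]; rewrite !E => /andP[lo hi]; exists (lam^-1 * y).
  exists k => //=; rewrite /grid /= in_itv /=.
  by rewrite ler_pdivlMl// ltr_pdivrMl// lo.
by rewrite mulVKf// gt_eqF.
Qed.

(** A block has half side less than [rho], so the ball about its midpoint covers it; [Y] only has to
    contain the blocks that meet [ball x r]. *)
Lemma covnum_blocks_ball_le (R : realType) (rho h x r : R) (M : nat)
    (X Y : {set 'I_M}) :
  h < 2 * rho ->
  (forall k, k \in X -> k%:R * h < x + r -> x - r < k.+1%:R * h -> k \in Y) ->
  (covnum rho (blocks h X `&` ball x r) <= #|Y|)%N.
Proof.
move=> h_lt inY.
have /covnumP[] // : covered_by rho (blocks h X `&` ball x r) #|Y|.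
apply: (covered_by_card _ _ _ (fun k : 'I_M => (k%:R + 2^-1) * h)) => y.
move=> [[k kX /andP[lo hi]] /ballRE/andP[xl xr]]; exists k.
  apply: inY => //; [exact: le_lt_trans xr|exact: lt_trans hi].
apply/ballRE; rewrite -natr1 in hi; apply/andP; split; nra.
Qed.

Lemma card_bounded_fibers (T : finType) (X : {set T}) (g : T -> nat) (n c : nat) :
  {in X, forall k, (g k < n)%N} ->
  (forall i, #|[set k in X | g k == i]%SET| <= c)%N ->
  (#|X| <= n * c)%N.
Proof.
case: n => [|n] g_lt fib.
  have [->|[k /g_lt//]] := set_0Vmem X; first by rewrite cards0.
rewrite -sum1_card (partition_big (fun k => inord (g k) : 'I_n.+1) xpredT)//=.
rewrite -[X in (_ <= X * _)%N](card_ord n.+1) -sum_nat_const.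
apply: leq_sum => i _; apply: leq_trans (fib i); rewrite -sum1_card.
rewrite [X in (X <= _)%N](eq_bigl (mem [set k in X | g k == i]%SET))// => k.
rewrite !inE; apply: andb_id2l => kX; rewrite -val_eqE /= inordK//; exact: g_lt.
Qed.

(** Left endpoints are counted. Two of them in one ball are less than [2 * rho <= 2 * h] apart, so a
    ball holds at most three. *)
Lemma covnum_blocks_ge (R : realType) (rho h : R) (M : nat) (X : {set 'I_M}) :
  0 < rho -> rho <= h -> h < 2 * rho ->
  (#|X| <= 3 * covnum rho (blocks h X))%N.
Proof.
move=> rho_gt0 rho_le h_lt; have h_gt0 : 0 < h by exact: lt_le_trans rho_le.
have : covered_by rho (blocks h X) #|X|.
  apply: (covered_by_card _ _ _ (fun k : 'I_M => (k%:R + 2^-1) * h)) => y.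
  move=> [k kX /andP[lo hi]]; exists k => //.
  apply/ballRE; rewrite -natr1 in hi; apply/andP; split; nra.
case/covnumP=> -[c cov] _; move: (covnum _ _) c cov => n c cov.
(* [g] names a ball containing the left endpoint of each block; outside [X] it takes the dummy value
   0. *)
have pick (k : 'I_M) : exists i : nat, k \in X ->
    exists2 j : 'I_n, i = j & ball (c j) rho (k%:R * h).
  case: (boolP (k \in X)) => kX; last by exists 0%N.
  have [|j _ kj] := cov (k%:R * h); last by exists j => _; exists j.
  by exists k => //; rewrite lexx ltr_pM2r// ltr_nat /=.
have [g gP] := boolp.choice pick.
have fib i : (#|[set k in X | g k == i]%SET| <= 3)%N.
  rewrite -[X in (_ <= X)%N]muln1.
  apply: (card_close_fibers _ _ val) => [k k'|p].
    rewrite !inE => /andP[kX /eqP ki] /andP[k'X /eqP k'i].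
    have [j ij /ballRE kj] := gP k kX; have [j' ij' /ballRE k'j] := gP k' k'X.
    have jj : j = j' by apply: val_inj; rewrite /= -ij -ij' ki k'i.
    move: kj k'j; rewrite jj => /andP[_ hi] /andP[lo _].
    rewrite -(ltr_nat R) natrD.
    rewrite -(ltr_pM2r h_gt0); lra.
  apply/card_le1_eqP => k k'; rewrite !inE => /andP[_ /eqP kp] /andP[_ /eqP k'p].
  by apply: val_inj; rewrite /= kp k'p.
rewrite mulnC; apply: (card_bounded_fibers _ _ g _ _ _ fib) => k kX.
by have [j -> _] := gP k kX.
Qed.

(** * Scales *)

Lemma pow2_gt0 (R : realType) (x : R) : 0 < 2 `^ x :> R.
Proof. exact: powR_gt0. Qed.

Lemma pow2D (R : realType) (x y : R) : 2 `^ (x + y) = 2 `^ x * 2 `^ y :> R.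
Proof. by rewrite powRD// pnatr_eq0 implybT. Qed.

Lemma pow2_le (R : realType) (x y : R) : x <= y -> 2 `^ x <= 2 `^ y :> R.
Proof. by apply: ler_powR; rewrite ler1n. Qed.

Lemma pow2_lt (R : realType) (x y : R) : x < y -> 2 `^ x < 2 `^ y :> R.
Proof.
by move=> xy; rewrite /powR pnatr_eq0 ltr_expR ltr_pM2r// ln_gt0// ltr1n.
Qed.

Lemma pow2_natr (R : realType) (n : nat) : 2 `^ n%:R = 2 ^+ n :> R.
Proof. by rewrite powR_mulrn. Qed.

(** The generation of the grid at scale 2^(-jT), rounded down because [T] need not be an integer. *)
Definition level {R : realType} (T : R) (j : nat) : nat :=
  Num.truncn (j%:R * T).

Lemma level_itv (R : realType) (T : R) (j : nat) : 0 <= T ->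
  2 ^+ level T j <= 2 `^ (j%:R * T) < 2 * 2 ^+ level T j.
Proof.
move=> T_ge0; have jT_ge0 : 0 <= j%:R * T by rewrite mulr_ge0.
have /andP[lo hi] := truncn_itv jT_ge0.
rewrite -exprS -!pow2_natr pow2_le//=.
exact: pow2_lt.
Qed.

Lemma level_homo (R : realType) (T : R) : 0 <= T ->
  {homo level T : i j / (i <= j)%N}.
Proof.
by move=> T_ge0 i j ij; rewrite /level le_truncn// ler_wpM2r// ler_nat.
Qed.

Lemma first_scale (R : realType) (w : nat -> R) (d : nat) (r : R) :
  r <= w 0%N -> w d.+1 <= r ->
  exists2 i, (i <= d)%N & r <= w i /\ w i.+1 <= r.
Proof.
move=> r_le w_le; have ex : exists i, w i.+1 <= r by exists d.
have [i wi imin] := ex_minnP ex; exists i; first exact: imin.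
split=> //; case: i imin {wi} => // i imin.
by rewrite leNgt; apply/negP => /ltW /imin; rewrite ltnn.
Qed.

Lemma block_ancestor (R : realType) (h : R) (d k : nat) : 0 <= h ->
  (k %/ d)%:R * (d%:R * h) <= k%:R * h.
Proof.
by move=> h_ge0; rewrite mulrA ler_wpM2r// -natrM ler_nat leq_divM.
Qed.

Lemma block_ancestorS (R : realType) (h : R) (d k : nat) : 0 <= h -> (0 < d)%N ->
  k.+1%:R * h <= (k %/ d).+1%:R * (d%:R * h).
Proof.
by move=> h_ge0 d_gt0; rewrite mulrA ler_wpM2r// -natrM ler_nat -ltn_divLR.
Qed.

Lemma pow_level_split (R : realType) (T lam : R) (i j : nat) : 0 <= T -> (i <= j)%N ->
  lam / 2 ^+ level T i = (2 ^ (level T j - level T i))%:R * (lam / 2 ^+ level T j).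
Proof.
move=> T_ge0 ij; have := level_homo R T T_ge0 i j ij => le_ij.
rewrite natrX -[in RHS](subnK le_ij) addnK exprD.
by field; rewrite !expf_neq0.
Qed.

(** * Non-concentration of the rescaled descendants *)

(** The radius is at most the rescaled side of a cell of generation [i], so the ball meets at most
    three such cells. By uniformity each has P(j') / P(i) descendants, where P counts cells; the
    bound is multiplied out to avoid division. *)
Lemma covnum_descendants_ball (R : realType) (T : R) (N : nat)
    (S : {set 'I_(2 ^ N)}) (j i j' k : nat) (x r h : R) :
  0 <= T -> (j <= i <= j')%N -> (level T j' <= N)%N ->
  uniform_at S (level T i) -> uniform_at S (level T j') ->
  r <= 2 `^ (- ((i%:R - j%:R) * T)) ->
  h = 2 `^ (j%:R * T) / 2 ^+ level T j' ->
  (covnum (2 `^ (- ((j'%:R - j%:R) * T)))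
     (blocks h (below (cells S (level T j')) (level T j) k) `&` ball x r)
     * #|cells S (level T i)| <= 3 * #|cells S (level T j')|)%N.
Proof.
move=> T_ge0 /andP[ji ij'] levN ui uj' r_le hE.
set rho := 2 `^ (- ((j'%:R - j%:R) * T)).
set U := below _ _ _.
pose d := (2 ^ (level T j' - level T i))%N.
have d_gt0 : (0 < d)%N by rewrite expn_gt0.
have lam_gt0 : 0 < 2 `^ (j%:R * T) :> R by exact: pow2_gt0.
have h_gt0 : 0 < h by rewrite hE divr_gt0 ?exprn_gt0.
have scale (p : nat) : 2 `^ (- ((p%:R - j%:R) * T)) * 2 `^ (p%:R * T) = 2 `^ (j%:R * T).
  by rewrite -pow2D; congr (2 `^ _); ring.
have h_lt : h < 2 * rho.
  rewrite hE ltr_pdivrMr ?exprn_gt0// -(scale j') -/rho.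
  have /andP[_ hi] := level_itv R T j' T_ge0.
  by rewrite (mulrC 2) -mulrA ltr_pM2l ?pow2_gt0.
have r_le_h : r <= d%:R * h.
  rewrite hE -pow_level_split//; apply: le_trans r_le _.
  rewrite ler_pdivlMr ?exprn_gt0// -(scale i) ler_pM2l ?pow2_gt0//.
  by have /andP[] := level_itv R T i T_ge0.
pose Y := [set k in U | (k%:R * h < x + r) && (x - r < k.+1%:R * h)]%SET.
have cov_le : (covnum rho (blocks h U `&` ball x r) <= #|Y|)%N.
  by apply: covnum_blocks_ball_le => // y yU lo hi; rewrite inE yU lo.
apply: leq_trans (leq_mul cov_le (leqnn _)) _.
set P := #|cells S (level T i)|; set P' := #|cells S (level T j')|.
have [->|P_gt0] := posnP P; first by rewrite muln0.
have levi : (level T i <= level T j')%N by exact: level_homo.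
suff Y_le : (#|Y| <= 3 * (P' %/ P))%N.
  apply: leq_trans (leq_mul Y_le (leqnn _)) _.
  by rewrite -mulnA leq_mul2l leq_divM orbT.
(* Blocks are grouped by their ancestor of generation [i]. The left endpoints of two ancestors met
   by the ball differ by less than [2 * r + d * h], hence by less than three sides [d * h]. *)
apply: (card_close_fibers _ _ (fun y : 'I_(2 ^ level T j') => (y %/ d)%N)) => [y y'|p].
  rewrite !inE => /andP[_ /andP[lo _]] /andP[_ /andP[_ hi]].
  have := block_ancestor R h d y (ltW h_gt0).
  have := block_ancestorS R h d y' (ltW h_gt0) d_gt0.
  rewrite -(ltr_nat R) natrD -(ltr_pM2r (_ : 0 < d%:R * h)); last first.
    by rewrite mulr_gt0 ?ltr0n.
  rewrite -[(y' %/ d).+1%:R]natr1; lra.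
rewrite leq_divRL//; apply: leq_trans (card_descendants_le _ _ N p S levi levN ui uj').
rewrite leq_mul2r subset_leq_card ?orbT//; apply/fintype.subsetP => y.
by rewrite !inE => /andP[/andP[/andP[-> _] _] ->].
Qed.

(** All these blocks lie in one rescaled cell of generation [j], whose side [H] is below 2 because
    [level] rounds by less than one. *)
Lemma blocks_below_diam (R : realType) (T : R) (n' j j' k : nat)
    (Q : {set 'I_(2 ^ level T j')}) (x y : R) :
  0 <= T -> (j <= j')%N ->
  let A := blocks (2 `^ (j%:R * T) / 2 ^+ level T j') (below Q (level T j) k) in
  A x -> A y -> `|x - y| <= 2.
Proof.
move=> T_ge0 jj' A.
have lam_gt0 : 0 < 2 `^ (j%:R * T) :> R by exact: pow2_gt0.
set H := 2 `^ (j%:R * T) / 2 ^+ level T j.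
have H_lt : H < 2.
  rewrite ltr_pdivrMr ?exprn_gt0//.
  by have /andP[] := level_itv R T j T_ge0.
have loc z : A z -> k%:R * H <= z < k.+1%:R * H.
  have h_ge0 : 0 <= 2 `^ (j%:R * T) / 2 ^+ level T j' :> R.
    by rewrite divr_ge0 ?exprn_ge0// ltW.
  move=> [q]; rewrite inE => /andP[_ /eqP qk] /andP[lo hi].
  have d_gt0 : (0 < 2 ^ (level T j' - level T j))%N by rewrite expn_gt0.
  rewrite /H (pow_level_split R T _ j j')// -qk.
  rewrite (le_trans (block_ancestor _ _ _ _ _))//=.
  by rewrite (lt_le_trans hi)// block_ancestorS.
move=> /loc/andP[xl xr] /loc/andP[yl yr]; rewrite -natr1 mulrDl mul1r in xr yr.
by rewrite ler_norml; apply/andP; split; lra.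
Qed.

(** A ball of radius about 2^(-iT) needs at most 3 P(j') / P(j+i) covering balls, and the whole set
    at least P(j') / (3 P(j)). The growth hypothesis controls the quotient; rounding the radius
    costs a further 2^T. *)
Lemma delta_set_descendants (R : realType) (T t e K : R) (N : nat)
    (S : {set 'I_(2 ^ N)}) (j j' : nat) (I : 'I_(2 ^ level T j)) :
  0 <= T -> (j <= j')%N -> (level T j' <= N)%N ->
  (forall i, (j <= i <= j')%N -> uniform_at S (level T i)) ->
  I \in cells S (level T j) ->
  0 <= t <= 1 -> 9 * 2 `^ T <= K ->
  (forall i, (j <= i <= j')%N ->
     #|cells S (level T j)|%:R
       * 2 `^ (t * (i%:R - j%:R) * T - (j'%:R - j%:R) * T * e)
     <= #|cells S (level T i)|%:R) ->
  delta_set K (2 `^ (- ((j'%:R - j%:R) * T))) t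
    (K * 2 `^ ((j'%:R - j%:R) * T * e))
    (blocks (2 `^ (j%:R * T) / 2 ^+ level T j')
       (below (cells S (level T j')) (level T j) I)).
Proof.
move=> T_ge0 jj' levN unif IS /andP[t_ge0 t_le1] K_ge growth.
set h := 2 `^ (j%:R * T) / _; set U := below _ _ _.
have pow_ge1 : 1 <= 2 `^ T :> R by rewrite -[X in X <= _](powRr0 2) pow2_le.
have h_gt0 : 0 < h by rewrite divr_gt0 ?pow2_gt0 ?exprn_gt0.
have uj : uniform_at S (level T j) by apply: unif; rewrite leqnn.
have uj' : uniform_at S (level T j') by apply: unif; rewrite leqnn andbT.
have levjj' := level_homo R T T_ge0 j j' jj'.
have cardU := card_descendants _ _ N S I levjj' levN uj uj' IS.
have P_gt0 : (0 < #|cells S (level T j)|)%N by apply/card_gt0P; exists I.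
have P'_gt0 : (0 < #|cells S (level T j')|)%N.
  exact: leq_trans P_gt0 (card_cells_monotone N _ _ S levjj' levN).
have /card_gt0P[u uU] : (0 < #|U|)%N.
  by move: P'_gt0; rewrite -cardU muln_gt0 => /andP[].
split.
- by exists (u%:R * h), u => //; rewrite lexx /= ltr_pM2r// ltr_nat.
- move=> x y Ax Ay; apply: (@le_trans _ _ 2); last lra.
  exact: (blocks_below_diam R T 0 j j' I (cells S (level T j'))).
move=> x r /andP[r_ge r_le].
set rho := 2 `^ _ in r_ge *.
(* At the generation i with 2^(-(i+1)T) <= r <= 2^(-iT), counted from
   generation j, the ball meets at most three cells. *)
pose w i := 2 `^ (- (i%:R * T)) : R.
have [i id [r_lew w_ler]] : exists2 i, (i <= j' - j)%N & r <= w i /\ w i.+1 <= r.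
  apply: first_scale; first by rewrite /w mul0r oppr0 powRr0.
  apply: le_trans r_ge; apply: pow2_le; rewrite lerN2 ler_wpM2r// -natrB//.
  by rewrite ler_nat.
have jij' : (j <= j + i <= j')%N by rewrite leq_addr -leq_subRL.
have iE : (j + i)%:R - j%:R = i%:R :> R by rewrite natrD; ring.
have r_leij : r <= 2 `^ (- (((j + i)%:R - j%:R) * T)) by rewrite iE.
have := covnum_descendants_ball R T N S j (j + i) j' I x r h T_ge0 jij' levN
  (unif _ jij') uj' r_leij erefl.
rewrite -/rho -/U; set c := covnum _ (_ `&` _); rewrite -cardU => c_le.
have h_ge : rho <= h.
  rewrite /h ler_pdivlMr ?exprn_gt0//.
  have -> : j%:R * T = - ((j'%:R - j%:R) * T) + j'%:R * T by ring.
  rewrite pow2D ler_pM2l ?pow2_gt0//.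
  by have /andP[] := level_itv R T j' T_ge0.
have h_lt : h < 2 * rho.
  rewrite /h ltr_pdivrMr ?exprn_gt0//.
  have -> : j%:R * T = - ((j'%:R - j%:R) * T) + j'%:R * T by ring.
  rewrite pow2D (mulrC 2) -mulrA ltr_pM2l ?pow2_gt0//.
  by have /andP[] := level_itv R T j' T_ge0.
have := covnum_blocks_ge R rho h _ U (pow2_gt0 _ _) h_ge h_lt.
set C := covnum _ (blocks h U) => U_le.
set P := #|cells S (level T j)| in P_gt0 c_le growth *.
have := growth _ jij'; rewrite iE.
set Pi := #|cells S _| in c_le * => growth_i.
(* The constant 9 is 3 * 3: three cells met by the ball, and three blocks per covering ball. *)
have cPi : (c * Pi <= 9 * C * P)%N.
  apply: leq_trans c_le _; rewrite mulnA leq_mul2r; apply/orP; right.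
  by apply: leq_trans (leq_mul (leqnn 3) U_le) _; rewrite mulnA.
set D := (j'%:R - j%:R) * T * e in growth_i *.
(* Passing from generation [i] to [i.+1] costs 2^(tT), which is at most 2^T since [t <= 1]. *)
have r_pow : 2 `^ (- (t * i%:R * T)) <= 2 `^ T * r `^ t.
  have r_gt0 : 0 < r by exact: lt_le_trans (pow2_gt0 _ _) r_ge.
  have : (w i.+1) `^ t <= r `^ t.
    by apply: ge0_ler_powR => //; rewrite nnegrE ltW// pow2_gt0.
  rewrite -powRrM; move/(ler_wpM2l (ltW (pow2_gt0 R T))); apply: le_trans.
  rewrite -pow2D pow2_le// -natr1; nra.
have Pi_gt0 : 0 < Pi%:R :> R.
  by apply: lt_le_trans growth_i; rewrite mulr_gt0 ?ltr0n// pow2_gt0.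
rewrite -(ler_pM2r Pi_gt0).
apply: (@le_trans _ _ (9 * C%:R * P%:R)).
  by rewrite -!natrM ler_nat.
(* Inserting this factor makes the lower bound [growth_i] for [Pi] appear on the left. *)
have key : 1 <= 2 `^ T * r `^ t * (2 `^ D * 2 `^ (t * i%:R * T - D)).
  rewrite -pow2D addrC subrK; apply: le_trans (ler_wpM2r (ltW (pow2_gt0 _ _)) r_pow).
  by rewrite -pow2D addNr powRr0.
have r_ge0 : 0 <= r `^ t by exact: powR_ge0.
apply: (@le_trans _ _ (9 * 2 `^ T * 2 `^ D * r `^ t * C%:R *
    (P%:R * 2 `^ (t * i%:R * T - D)))).
  have -> : 9 * 2 `^ T * 2 `^ D * r `^ t * C%:R *
      (P%:R * 2 `^ (t * i%:R * T - D)) =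
      9 * C%:R * P%:R * (2 `^ T * r `^ t * (2 `^ D * 2 `^ (t * i%:R * T - D))).
    by ring.
  by rewrite ler_peMr ?mulr_ge0.
have D_ge0 : 0 <= 2 `^ D :> R by exact: powR_ge0.
have T2_ge0 : 0 <= 2 `^ T :> R by exact: powR_ge0.
apply: ler_pM growth_i; rewrite ?mulr_ge0 ?powR_ge0//.
by rewrite ler_wpM2r// ler_wpM2r// ler_wpM2r.
Qed.

(** * Size of the uniformity parameters *)

Lemma ln2_ge_half (R : realType) : 2^-1 <= ln 2 :> R.
Proof.
have := @le_ln1Dx R (- 2^-1) ltac:(lra).
have -> : 1 + - 2^-1 = 2^-1 :> R by field.
by rewrite lnV ?posrE// lerN2.
Qed.

(** The equation reads ln(2 Te) = eps Te. The lower bound uses ln 2 >= 1/2; the upper one uses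
    ln(s^2) <= 2 s with s^2 = 2 Te, then squares. *)
Lemma Teps_bounds (R : realType) (eps Te : R) : 0 < eps -> is_Teps eps Te ->
  (2 * eps)^-1 <= Te /\ Te <= 8 / eps ^+ 2.
Proof.
move=> eps_gt0 [Te_ge1 TeE]; have Te_gt0 : 0 < Te by lra.
have lnE : ln (2 * Te) = eps * Te by rewrite -TeE mulrAC mulVf ?mul1r// gt_eqF.
split.
  have : ln 2 <= ln (2 * Te) by rewrite ler_ln ?posrE ?mulr_gt0//; lra.
  have := ln2_ge_half R; rewrite lnE invfM => ln2 le2.
  rewrite ler_pdivrMr//; lra.
pose s := Num.sqrt (2 * Te); have s_gt0 : 0 < s by rewrite sqrtr_gt0 mulr_gt0.
have ss : s ^+ 2 = 2 * Te by rewrite sqr_sqrtr// mulr_ge0// ltW.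
have : eps * Te <= 2 * s.
  rewrite -lnE -ss lnXn// -[X in X <= _]mulr_natl ler_pM2l//.
  have := @le_ln1Dx R (s - 1) ltac:(lra); rewrite addrC subrK; lra.
move=> epsT_le; rewrite ler_pdivlMr ?exprn_gt0//.
have : (eps * Te) ^+ 2 <= (2 * s) ^+ 2.
  by rewrite ler_pXn2r ?nnegrE ?mulr_ge0// ltW.
rewrite [X in _ <= X]exprMn ss -(ler_pM2r Te_gt0) => {}epsT_le.
rewrite -(ler_pM2r Te_gt0); nra.
Qed.

Lemma logb2_pow (R : realType) (x : R) : logb 2 (2 `^ (- x))^-1 = x.
Proof.
by rewrite /logb -powRN opprK ln_powR mulfK// gt_eqF// ln_gt0// ltr1n.
Qed.

Lemma lev_pow2 (R : realType) (x : R) : lev (2 `^ (- x)) = Num.truncn x.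
Proof. by rewrite /lev logb2_pow. Qed.

Lemma exprVn_pow2 (R : realType) (N : nat) : 2 ^- N = 2 `^ (- N%:R) :> R.
Proof. by rewrite powRN pow2_natr. Qed.

(** By maximality [m.+1] blocks would be shorter than [Te], and (m + 1) / m is at most 2. *)
Lemma nblocks_bounds (R : realType) (delta Te : R) (m : nat) :
  0 < Te -> is_nblocks delta Te m ->
  Te <= m%:R^-1 * logb 2 delta^-1 <= 2 * Te.
Proof.
move=> Te_gt0 [m_gt0 Te_le mmax]; rewrite Te_le /=.
have := mmax m.+1 isT; rewrite ltnn.
have mR_gt0 : 0 < m%:R :> R by rewrite ltr0n.
have m1R : 1 <= m%:R :> R by rewrite ler1n.
set l := logb 2 _ => nle; rewrite mulrC ler_pdivrMr//.
have [l_lt|/nle//] := ltP (m.+1%:R^-1 * l) Te.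
by move: l_lt; rewrite mulrC ltr_pdivrMr ?ltr0n// -natr1; nra.
Qed.

Lemma pow2_log (R : realType) (P : R) : 0 < P -> 2 `^ (ln P / ln 2) = P.
Proof.
move=> P_gt0; have ln2_gt0 : 0 < ln 2 :> R by rewrite ln_gt0// ltr1n.
by rewrite /powR pnatr_eq0 divfK ?gt_eqF// lnK.
Qed.

(* The last bound is what makes psi(eps) at most (eps^3)^n. *)
Lemma group_count (R : realType) (eps : R) : 0 < eps -> eps <= 14^-1 ->
  exists n : nat, [/\ 1 + eps <= 2 * eps * n%:R, n%:R * eps <= 1 + eps
    & 3 * n%:R <= 2 / eps - 1].
Proof.
(* The 2 added to the truncation makes up for rounding and for the [eps] in [1 + eps]. The last
   bound then needs 1 / (2 eps) >= 7, whence the threshold 1/14. *)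
move=> eps_gt0 eps_le; exists (Num.truncn (2 * eps)^-1 + 2)%N.
have inv_ge0 : 0 <= (2 * eps)^-1 by rewrite invr_ge0 mulr_ge0// ltW.
have /andP[] := truncn_itv inv_ge0.
rewrite -[X in _ < X]natr1 natrD; move: (Num.truncn _)%:R => n lo hi.
have E : eps * (2 * eps)^-1 = 2^-1 by field; rewrite gt_eqF.
have E2 : 2 / eps = 4 * (2 * eps)^-1 by field; rewrite gt_eqF.
have inv_ge : 7 <= (2 * eps)^-1.
  rewrite -(ler_pM2l eps_gt0) E; lra.
rewrite E2; split.
- have : eps * (2 * eps)^-1 <= eps * (n + 1) by rewrite ler_pM2l//; exact: ltW.
  rewrite E; lra.
- have : eps * n <= eps * (2 * eps)^-1 by rewrite ler_pM2l.
  rewrite E; lra.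
- lra.
Qed.

(** * From the branching function to the claims on one scale interval *)

(** [f] is the base 2 logarithm of the cell count, divided by [T]. Rounding the levels costs at most
    one bit, and for [i < j] the bound [1 <= eps * T] absorbs it in the slope [1 + eps]. *)
Lemma growth_exponent (R : realType) (eps T : R) (m N : nat)
    (S : {set 'I_(2 ^ N)}) :
  0 < T -> 1 <= eps * T -> (level T m <= N)%N -> S != finset.set0 ->
  (forall j, (j <= m)%N -> uniform_at S (level T j)) ->
  exists f : nat -> R,
    [/\ f 0%N = 0,
        forall j, (j <= m)%N -> #|cells S (level T j)|%:R = 2 `^ (T * f j),
        forall i j, (i <= j)%N -> (j <= m)%N -> f i <= f j
      & forall i j, (i <= j)%N -> (j <= m)%N ->
          f j - f i <= (1 + eps) * (j%:R - i%:R)].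
Proof.
move=> T_gt0 T_ge levN S_neq0 unif.
have ln2_gt0 : 0 < ln 2 :> R by rewrite ln_gt0// ltr1n.
pose P j := #|cells S (level T j)|.
have lev_homo := level_homo R T (ltW T_gt0).
have lev_le j : (j <= m)%N -> (level T j <= N)%N.
  by move=> jm; apply: leq_trans levN; exact: lev_homo.
have P_gt0 j : (j <= m)%N -> 0 < (P j)%:R :> R.
  by move=> /lev_le jm; rewrite ltr0n card_cells_gt0.
pose f j := ln (P j)%:R / ln 2 / T : R.
have PE j : (j <= m)%N -> (P j)%:R = 2 `^ (T * f j).
  by move=> jm; rewrite /f mulrC divfK ?gt_eqF// pow2_log// P_gt0.
exists f; split=> //.
- have -> : f 0%N = ln #|cells S (level T 0)|%:R / ln 2 / T by [].
  have -> : level T 0 = 0%N by rewrite /level mul0r (natrK 0).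
  by rewrite cells_root// ln1 !mul0r.
- move=> i j ij jm; rewrite /f ler_pM2r ?invr_gt0// ler_pM2r ?invr_gt0//.
  rewrite ler_ln ?posrE ?P_gt0 ?(leq_trans ij)//.
  by rewrite ler_nat card_cells_monotone ?lev_homo ?lev_le.
- move=> i j; rewrite leq_eqVlt => /predU1P[->|ij] jm; first by rewrite !subrr mulr0.
  have im := leq_trans (ltnW ij) jm.
  have ijR : i%:R + 1 <= j%:R :> R by rewrite natr1 ler_nat.
  have lev_ij := lev_homo _ _ (ltnW ij).
  have := card_cells_growth N _ _ S lev_ij (lev_le j jm) S_neq0 (unif i im) (unif j jm).
  rewrite -(ler_nat R) natrM natrX => grow.
  have : 2 `^ (T * f j) <= 2 `^ ((j%:R * T - i%:R * T + 1) + T * f i).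
    rewrite -PE// pow2D -PE//; apply: le_trans grow _; rewrite ler_wpM2r//.
    rewrite -pow2_natr pow2_le// natrB//.
    have /andP[lo _] := truncn_itv (mulr_ge0 (ler0n R j) (ltW T_gt0)).
    have /andP[_ hi] := truncn_itv (mulr_ge0 (ler0n R i) (ltW T_gt0)).
    move: lo hi; rewrite -/(level T j) -/(level T i) -natr1; lra.
  rewrite leNgt => /negP nlt; rewrite leNgt; apply/negP => lt; apply: nlt.
  apply: pow2_lt; nra.
Qed.

(** With delta^(j/m) = 2^(-jT), the cell [I] has exactly 2^(T (f a' - f a)) descendants, so bounds
    on [f] become bounds on exponents. The loss [3 * eps] is that of the upper slope bound and
    dominates the lower loss [eps]. *)
Lemma scale_interval (R : realType) (eps T K t : R) (m N a a' : nat)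
    (S : {set 'I_(2 ^ N)}) (f : nat -> R) :
  let delta : R := 2 ^- N in
  let A : R := a%:R / m%:R in
  let A' : R := a'%:R / m%:R in
  0 < eps -> 0 < T -> (0 < m)%N -> m%:R * T = N%:R -> 9 * 2 `^ T <= K ->
  (forall j, (j <= m)%N -> uniform_at S (level T j)) ->
  (forall j, (j <= m)%N -> #|cells S (level T j)|%:R = 2 `^ (T * f j)) ->
  (a < a')%N -> (a' <= m)%N -> 0 <= t <= 1 ->
  f a' - f a <= (t + 3 * eps) * (a'%:R - a%:R) ->
  (forall i, (a <= i <= a')%N ->
     f a + t * (i%:R - a%:R) - eps * (a'%:R - a%:R) <= f i) ->
  logb delta^-1 (#|coarse S (delta `^ A')|%:R / #|coarse S (delta `^ A)|%:R)
    <= (t + 3 * eps) * (A' - A)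
  /\ forall I, I \in coarse S (delta `^ A) ->
    let SI := inside R (coarse S (delta `^ A')) (lev (delta `^ A)) I in
    [/\ delta_set K (delta `^ (A' - A)) t (K * delta `^ ((A - A') * (3 * eps)))
          [set delta `^ (- A) * x | x in gridU R SI],
        K^-1 * delta `^ ((A - A') * (t - 3 * eps)) <= #|SI|%:R
      & #|SI|%:R <= K * delta `^ ((A - A') * (t + 3 * eps))].
Proof.
move=> delta A A' eps_gt0 T_gt0 m_gt0 mT K_ge unif PE aa' a'm t01 f_le f_ge.
have T_ge0 := ltW T_gt0; have ln2_gt0 : 0 < ln 2 :> R by rewrite ln_gt0// ltr1n.
have mR_gt0 : 0 < m%:R :> R by rewrite ltr0n.
have am := leq_trans (ltnW aa') a'm.
have lev_homo := level_homo R T T_ge0.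
have levm : level T m = N by rewrite /level mT natrK.
have lev_le j : (j <= m)%N -> (level T j <= N)%N.
  by move=> jm; rewrite -levm; exact: lev_homo.
have dpow x : delta `^ (x / m%:R) = 2 `^ (- (x * T)).
  rewrite /delta exprVn_pow2 -powRrM -mT; congr (2 `^ _).
  by field; rewrite gt_eqF.
have dlev j : lev (delta `^ (j%:R / m%:R)) = level T j.
  by rewrite dpow lev_pow2.
have coE j : (j <= m)%N ->
    coarse S (delta `^ (j%:R / m%:R)) = cells S (lev (delta `^ (j%:R / m%:R))).
  by move=> jm; apply: coarse_cells; rewrite dlev lev_le.
have lnd : ln delta^-1 = N%:R * ln 2 :> R by rewrite /delta invrK lnXn// mulr_natl.
rewrite /A /A' !coE// !dlev.
have Ediff : A' - A = (a'%:R - a%:R) / m%:R by rewrite /A /A'; ring.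
have Ediff' x : (A - A') * x = (- (a'%:R - a%:R) * x) / m%:R.
  by rewrite /A /A'; ring.
have EN : - A = (- a%:R) / m%:R by rewrite mulNr.
split.
  rewrite !PE// /logb lnd -/A -/A' Ediff ln_div ?posrE ?pow2_gt0// !ln_powR -mT.
  have -> : (T * f a' * ln 2 - T * f a * ln 2) / (m%:R * T * ln 2)
      = (f a' - f a) / m%:R by field; rewrite !gt_eqF.
  by rewrite mulrA ler_pM2r ?invr_gt0.
move=> I IS; rewrite /= inside_below ?lev_homo ?(ltnW aa')//.
rewrite -/A -/A' Ediff !Ediff' EN !dpow rescaled_gridU ?pow2_gt0//.
set l := a'%:R - a%:R.
have E1 : - (- l * (3 * eps) * T) = l * T * (3 * eps) by ring.
have E2 : - (- a%:R * T) = a%:R * T by ring.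
rewrite E1 E2.
have l_ge0 : 0 <= l * T by rewrite mulr_ge0// subr_ge0 ler_nat ltnW.
have uj i : (a <= i <= a')%N -> uniform_at S (level T i).
  by move=> /andP[_ ia]; exact: unif (leq_trans ia a'm).
have aaa' : (a <= a <= a')%N by rewrite leqnn ltnW.
have aa'a' : (a <= a' <= a')%N by rewrite leqnn ltnW.
have := card_descendants _ _ N S I (lev_homo _ _ (ltnW aa')) (lev_le _ a'm)
  (uj _ aaa') (uj _ aa'a') IS.
set U := below _ _ _ => /(congr1 (fun n => n%:R : R)).
rewrite natrM !PE// => cardU.
have UE : #|U|%:R = 2 `^ (T * (f a' - f a)).
  apply: (mulIf (lt0r_neq0 (pow2_gt0 R (T * f a)))).
  by rewrite cardU -pow2D; congr (2 `^ _); ring.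
have T2_ge1 : 1 <= 2 `^ T :> R by rewrite -[X in X <= _](powRr0 2) pow2_le.
have K_ge1 : 1 <= K by lra.
split.
- apply: (delta_set_descendants R T t (3 * eps) K N S a a' I) => //.
  + exact: ltnW.
  + exact: lev_le.
  + move=> i /andP[ai ia]; have im := leq_trans ia a'm.
    rewrite !PE// -pow2D pow2_le//.
    have := f_ge i; rewrite ai ia => /(_ isT).
    rewrite -(ler_pM2l T_gt0) -/l => fi.
    have : 0 <= l * T * eps by rewrite mulr_ge0// ltW.
    move: fi; lra.
- apply: (@le_trans _ _ (2 `^ (- (- l * (t - 3 * eps) * T)))).
    by rewrite ler_piMl ?powR_ge0// invf_le1//; lra.
  rewrite UE pow2_le//; have := f_ge a' aa'a'.
  rewrite -(ler_pM2l T_gt0) -/l => fi.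
  have : 0 <= l * T * eps by rewrite mulr_ge0// ltW.
  move: fi; lra.
- apply: (@le_trans _ _ (2 `^ (- (- l * (t + 3 * eps) * T)))).
    rewrite UE pow2_le//; move: f_le; rewrite -(ler_pM2l T_gt0) -/l; lra.
  by rewrite ler_peMl ?powR_ge0.
Qed.

Theorem theorem2p13 (R : realType) :
  exists phi : R -> R,
    [/\ forall eps, 0 < eps -> 0 <= phi eps,
        phi eps @[eps --> 0^'+] --> (0 : R)
      & \forall eps \near (0 : R)^'+,
        let eps0 := eps `^ (2 * eps^-1) in
        let psi := eps0 * eps^-1 in
        exists (delta0 K : R) (Lmax : nat),
          [/\ 0 < delta0, 0 < K &
          forall (N : nat) (S : {set 'I_(2 ^ N)}),
            let delta : R := 2 ^- N in
            delta < delta0 ->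
            S != finset.set0 ->
            uniform_intervals eps0 S ->
            exists (L : nat) (A t : nat -> R),
              [/\ (L <= Lmax)%N,
                  [/\ A 1%N = 0, A L.+1 = 1
                    & forall l, (1 <= l <= L)%N -> A l < A l.+1],
                  [/\ 0 <= t 1%N, t L <= 1
                    & forall l, (1 <= l < L)%N -> t l < t l.+1],
                  forall l, (1 <= l <= L)%N ->
                    [/\ 
                        psi <= A l.+1 - A l,
                        logb delta^-1
                            (#|coarse S (delta `^ A l.+1)|%:R
                             / #|coarse S (delta `^ A l)|%:R)
                          <= (t l + 3 * eps) * (A l.+1 - A l)
                      & 
                        forall I, I \in coarse S (delta `^ A l) ->
                          let SI := inside R (coarse S (delta `^ A l.+1))
                                      (lev (delta `^ A l)) I in
                          [/\ delta_set K (delta `^ (A l.+1 - A l)) (t l)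
                                (K * delta `^ ((A l - A l.+1) * phi eps))
                                [set delta `^ (- A l) * x | x in gridU R SI],
                              K^-1 * delta `^ ((A l - A l.+1) * (t l - phi eps))
                                <= #|SI|%:R
                            & #|SI|%:R
                                <= K * delta `^ ((A l - A l.+1) * (t l + phi eps))]]
                & 
                  t 1%N <= logb delta^-1 #|S|%:R + eps]]].
Proof.
(* [3 * eps] is the excess slope allowed by [slope_partition]. *)
exists (fun eps => 3 * eps); split.
- by move=> eps /ltW eps_ge0; rewrite mulr_ge0.
- rewrite -[X in _ --> X](mulr0 3); apply: cvgMr.
  apply: cvg_at_right_filter; exact: cvg_id.
near=> eps; pose eps0 := eps `^ (2 * eps^-1); pose psi := eps0 * eps^-1.
rewrite -/eps0 -/psi.
have eps_gt0 : 0 < eps by near: eps; exact: nbhs_right_gt.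
have eps_le : eps <= 14^-1.
  by near: eps; apply: nbhs_right_le; rewrite invr_gt0.
have eps0_gt0 : 0 < eps0 by exact: powR_gt0.
have eps_le1 : 0 < eps <= 1 by rewrite eps_gt0; lra.
have eps0_le : 2 * eps0 <= eps.
  have : eps0 <= eps `^ 2.
    apply: ger_powR => //; rewrite ler_peMr// invf_ge1//; lra.
  rewrite (powR_mulrn 2 (ltW eps_gt0)) => le2; nra.
have [n [n_ge n_le n_psi]] := group_count R eps eps_gt0 eps_le.
(* [psi] is [eps] to the power 2/eps - 1, and [3 * n] does not exceed this exponent. *)
have psi_le : psi <= (eps ^+ 3) ^+ n.
  rewrite -exprM -powR_mulrn ?(ltW eps_gt0)// /psi /eps0.
  rewrite -[X in _ * X]powR_inv1 ?(ltW eps_gt0)// -powRD; last first.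
    by apply/implyP => _; rewrite gt_eqF.
  by apply: ger_powR => //; rewrite natrM.
(* [K] bounds 9 * 2^T through T <= 2 Te and Te <= 8 / eps0^2, so it depends on [eps] only; the
   number of pieces is at most the number [n] of slopes. *)
exists 1, (9 * 2 `^ (2 * (8 / eps0 ^+ 2))), n; split=> //.
move=> N S; pose delta : R := 2 ^- N; rewrite -/delta => _ S_neq0 [Te [m [TeP _ mP unif]]].
have [Te_ge Te_le] := Teps_bounds R eps0 Te eps0_gt0 TeP.
have Te_gt0 : 0 < Te by apply: lt_le_trans Te_ge; rewrite invr_gt0 mulr_gt0.
have m_gt0 : (0 < m)%N by case: mP.
have mR_gt0 : 0 < m%:R :> R by rewrite ltr0n.
have := nblocks_bounds R delta Te m Te_gt0 mP.
have logd : logb 2 delta^-1 = N%:R by rewrite /delta exprVn_pow2 logb2_pow.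
move: unif; rewrite /= logd; set T := m%:R^-1 * N%:R => unif /andP[T_ge T_le].
have T_gt0 : 0 < T by exact: lt_le_trans T_ge.
have mT : m%:R * T = N%:R by rewrite /T mulrA divff ?mul1r// gt_eqF.
(* The lower bound 1 / (2 eps0) for [Te] carries over to [T], and [2 * eps0 <= eps]. *)
have epsT : 1 <= eps * T.
  have : 1 <= 2 * eps0 * T.
    rewrite -ler_pdivrMl ?mulr_gt0// mulr1; exact: le_trans T_ge.
  have : 2 * eps0 * T <= eps * T by rewrite ler_pM2r.
  lra.
have levm : level T m = N by rewrite /level mT natrK.
have unifT j : (j <= m)%N -> uniform_at S (level T j).
  move=> jm; have jN : (level T j <= N)%N.
    by rewrite -[X in (_ <= X)%N]levm level_homo// ltW.
  have := unif j jm; rewrite coarse_cells ?lev_pow2//.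
  move=> u I1 I2 I1S I2S; have := u I1 I2 I1S I2S.
  by rewrite !inside_below.
have K_ge : 9 * 2 `^ T <= 9 * 2 `^ (2 * (8 / eps0 ^+ 2)).
  by rewrite ler_pM2l// pow2_le//; lra.
have levN : (level T m <= N)%N by rewrite levm.
have [f [f0 PE f_homo f_lip]] :=
  growth_exponent R eps T m N S T_gt0 epsT levN S_neq0 unifT.
have [L [a [t [/andP[L_gt0 L_le] [a0 aL] tP aP t0_le]]]] :=
  slope_partition R eps n m f eps_gt0 eps_le n_ge n_le m_gt0 f0 f_homo f_lip.
(* The statement numbers the scales from 1, while [a] and [t] start at 0. *)
exists L, (fun l => (a l.-1)%:R / m%:R), (fun l => t l.-1); split=> //.
- split; rewrite /= ?a0 ?mul0r ?aL ?divff ?gt_eqF// => -[|l]//= lL.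
  have [[al _] _ _ _] := aP l lL.
  by rewrite ltr_pM2r ?invr_gt0// ltr_nat.
- split=> [||[|l]//= lL].
  + by have [/andP[]] := tP 0%N L_gt0.
  + by have [|/andP[]] := tP L.-1; first by rewrite prednK.
  + by have [_] := tP l (ltnW lL); apply.
- case=> [|l]//= lL; have [[al am] len_ge f_le f_ge] := aP l lL.
  have [t01 _] := tP l lL.
  have [ii iii] := scale_interval R eps T _ (t l) m N (a l) (a l.+1) S f
    eps_gt0 T_gt0 m_gt0 mT K_ge unifT PE al am t01 f_le f_ge.
  split; [|exact: ii|exact: iii].
  rewrite -mulrBl ler_pdivlMr//; apply: le_trans len_ge.
  by rewrite ler_pM2r.
- have ln2_gt0 : 0 < ln 2 :> R by rewrite ln_gt0// ltr1n.
  have -> : #|S| = #|cells S (level T m)| by rewrite levm cells_full.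
  rewrite PE// /logb ln_powR /delta invrK lnXn// -[X in _ / X]mulr_natl -mT.
  have -> : T * f m * ln 2 / (m%:R * T * ln 2) = f m / m%:R.
    by field; rewrite !gt_eqF.
  by rewrite -(ler_pM2r mR_gt0) mulrDl divfK// gt_eqF.
Unshelve. all: by end_near.
Qed.
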